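(* Let $G$ be a locally compact group, $K$ a compact subgroup of $G$, $(\Omega,\mu)$ a measure space, $\Phi\in L^1_{loc}(\Omega,\mu)$, and $(\dot A(u))_{u\in\Omega}\subset \mathrm{Aut}_K(G)$ a family of homeomorphisms of $G/K$ induced by automorphisms $A(u)\in\mathrm{Aut}(G)$ with $A(u)(K)=K$. Let $p\in[1,\infty]$ and suppose that $$\|\Phi\|_{p,A}:=\int_\Omega |\Phi(u)|\,(\mathrm{mod}\,A(u))^{-1/p}\,d\mu(u)<\infty .$$ Then the Hausdorff operator $$(\mathcal{H}_{\Phi,\dot A}f)(\dot x)=\int_\Omega \Phi(u)\,f(\dot A(u)(\dot x))\,d\mu(u)$$ is bounded in $L^p(G/K)$ and $$\|\mathcal{H}_{\Phi,\dot A}\|_{\mathcal{L}(L^p(G/K))}\le \|\Phi\|_{p,A}.$$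
   Context: $G$ is a locally compact group with left Haar measure $\nu$ (write $dx=d\nu(x)$); $K\subset G$ is a compact subgroup with normalized Haar measure $dk$ ($\int_K dk=1$). $G/K$ is the space of left cosets $\dot x=xK=\pi_K(x)$, and $\lambda$ is a left-$G$-invariant measure on $G/K$, with $\nu$ normalized so that Weil's formula $\int_G g(x)\,dx=\int_{G/K}\left(\int_K g(xk)\,dk\right)d\lambda(\dot x)$ holds for all $g\in L^1(G)$. $L^p(G/K):=L^p(G/K,\lambda)$. $\mathcal{L}(Y)$ is the space of bounded linear operators on a normed space $Y$. $\mathrm{Aut}(G)$ is the set of topological automorphisms of $G$. For $A\in\mathrm{Aut}(G)$, $\mathrm{mod}\,A>0$ is the modulus, i.e. $\nu(A(E))=(\mathrm{mod}\,A)\,\nu(E)$ for Borel $E$; equivalently $\int_G g(A(x))\,dx=(\mathrm{mod}\,A)^{-1}\int_G g(x)\,dx$. If $A\in \mathrm{Aut}(G)$ and $A(K)=K$, then $\dot A:G/K\to G/K$, $\dot A(\dot x):=\pi_K(A(x))$, is a well-defined homeomorphism; $\mathrm{Aut}_K(G):=\{\dot A: A\in\mathrm{Aut}(G),\ A(K)=K\}$. For $p=\infty$ put $1/p=0$.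
   Formalization: The formal theorem additionally assumes that (u,x) ↦ Φ(u) f(A(u)x) is measurable on Ω × G/K for each f in L^p, and that |Φ|(mod A)^{-1/p} is measurable; without measurability of the family A(u) the integral defining the operator need not exist. *)

(* Defs.v *)
From HB Require Import structures.
From mathcomp Require Export all_boot all_order all_algebra.
From mathcomp Require Export all_classical all_reals all_analysis.
From mathcomp Require Export generic_quotient complex.

Set Implicit Arguments.
Unset Strict Implicit.
Unset Printing Implicit Defensive.
Import Order.TTheory GRing.Theory Num.Theory.
Import numFieldNormedType.Exports.

Local Open Scope classical_set_scope.
Local Open Scope ring_scope.
Local Open Scope quotient_scope.

Notation normc := ComplexField.Normc.normc.

(* Only pointed types carry generated sigma-algebras in the library, hence the
   ptopologicalType; the distinguished point plays no role. *)
HB.mixin Record isTopologicalGroup G of Group G & PointedTopological G := {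
  mulg_continuous : continuous (fun z : G * G => (z.1 * z.2)%g) ;
  invg_continuous : continuous (fun x : G => (x^-1)%g)
}.

#[short(type="topGroupType")]
HB.structure Definition TopologicalGroup :=
  {G of Group G & PointedTopological G & isTopologicalGroup G}.

Notation borel T := (g_sigma_algebraType (@open T)).

(* Radon measures are normalized to be inner regular on all Borel sets. Off the
   sigma-finite sets this differs from the "outer regular" normalization, for
   which L^oo has to be defined with locally null sets; with inner regularity
   every locally null set is null. *)
Definition radon (R : realType) (T : ptopologicalType)
    (m : {measure set (borel T) -> \bar R}) :=
  (forall C : set T, compact C -> (m C < +oo)%E) /\
  (forall E : set (borel T), measurable E ->
    m E = ereal_sup [set m C | C in [set C : set T | compact C /\ C `<=` E]]).

Definition left_haar (R : realType) (G : topGroupType)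
    (nu : {measure set (borel G) -> \bar R}) :=
  [/\ radon nu,
      nu setT != 0%E &
      forall (g : G) (E : set (borel G)), measurable E ->
        nu [set (g * x)%g | x in E] = nu E].

(* The normalized Haar measure dk of K, carried by K but seen as a Borel
   measure on G. *)
Definition normalized_haar (R : realType) (G : topGroupType) (K : groupClosed G)
    (kappa : {measure set (borel G) -> \bar R}) :=
  [/\ radon kappa,
      kappa [set` K] = 1%E,
      kappa (~` [set` K]) = 0%E &
      forall (k : G) (E : set (borel G)), k \in K -> measurable E ->
        kappa [set (k * x)%g | x in E] = kappa E].

Section coset_space.
Variables (G : topGroupType) (K : groupClosed G).

Definition same_coset : rel G := fun x y => (x^-1 * y)%g \in K.

Lemma same_coset_equiv : equiv_class_of same_coset.
Proof.
split=> [x|x y|y x z].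
- by rewrite /same_coset mulVg; exact: gpred1.
- by rewrite /same_coset -[(x^-1 * y)%g]invgK invgM invgK gpredV.
- rewrite /same_coset => xy yz.
  by have := gpredM _ _ xy yz; rewrite mulgA -(mulgA x^-1%g) mulgV mulg1.
Qed.

Canonical same_coset_equivRel := EquivRelPack same_coset_equiv.

Definition coset_space := quotient_topology {eq_quot same_coset}.

HB.instance Definition _ := PointedTopological.on coset_space.
HB.instance Definition _ := Quotient.on coset_space.

Definition coset_pi (x : G) : coset_space := \pi_coset_space x.

Definition coset_act (g : G) (y : coset_space) : coset_space :=
  coset_pi (g * repr y)%g.

Definition induced (A : G -> G) (y : coset_space) : coset_space :=
  coset_pi (A (repr y)).

End coset_space.

Definition left_invariant (R : realType) (G : topGroupType) (K : groupClosed G)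
    (lam : {measure set (borel (coset_space K)) -> \bar R}) :=
  forall (g : G) (E : set (borel (coset_space K))), measurable E ->
    lam [set coset_act g y | y in E] = lam E.

(* By invariance of dk the inner integral does not depend on the representative
   [repr y] of the coset y. *)
Definition weil_formula (R : realType) (G : topGroupType) (K : groupClosed G)
    (nu kappa : {measure set (borel G) -> \bar R})
    (lam : {measure set (borel (coset_space K)) -> \bar R}) :=
  forall g : borel G -> R, nu.-integrable setT (EFin \o g) ->
    (\int[nu]_x (g x)%:E =
     \int[lam]_y \int[kappa]_(k in [set` K]) (g (repr y * k)%g)%:E)%E.

Definition top_automorphism (G : topGroupType) (A : G -> G) :=
  [/\ {morph A : x y / (x * y)%g}, continuous A &
      exists B : G -> G, [/\ cancel A B, cancel B A & continuous B]].

(* m = mod A *)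
Definition is_modulus (R : realType) (G : topGroupType)
    (nu : {measure set (borel G) -> \bar R}) (A : G -> G) (m : R) :=
  0 < m /\ forall E : set (borel G), measurable E ->
    nu [set A x | x in E] = (m%:E * nu E)%E.

Section complex_functions.
Context d (T : measurableType d) (R : realType).
Variable m : {measure set T -> \bar R}.
Implicit Types (f g : T -> R[i]) (D : set T).

Definition cmeasurable f :=
  measurable_fun setT (fun x => complex.Re (f x)) /\
  measurable_fun setT (fun x => complex.Im (f x)).

Definition cintegrable D f :=
  m.-integrable D (fun x => (complex.Re (f x))%:E) /\
  m.-integrable D (fun x => (complex.Im (f x))%:E).

Definition cintegral D f : R[i] :=
  Complex (\int[m]_(x in D) complex.Re (f x))
          (\int[m]_(x in D) complex.Im (f x)).

(* An abstract measure space has no preferred notion of locality: [loc] is the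
   family of sets on which integrability is required (sets of finite measure,
   compact sets when T is a topological space, ...). *)
Definition L1loc (loc : set (set T)) f :=
  cmeasurable f /\ forall B, loc B -> measurable B -> cintegrable B f.

Definition Lp_norm (p : \bar R) f : \bar R :=
  'N[m]_p[(fun x => (normc (f x))%:E)]%E.

(* representatives of the elements of L^p *)
Definition Lp (p : \bar R) : set (T -> R[i]) :=
  [set f | cmeasurable f /\ (Lp_norm p f < +oo)%E].

(* H induces a linear operator on the space of a.e.-classes of Lp p *)
Definition Lp_linear (p : \bar R) (H : (T -> R[i]) -> T -> R[i]) :=
  [/\ forall f, Lp p f -> Lp p (H f),
      forall f g, Lp p f -> Lp p g -> f = g %[ae m] -> H f = H g %[ae m] &
      forall (a : R[i]) f g, Lp p f -> Lp p g ->
        H (fun x => a * f x + g x) = (fun x => a * H f x + H g x) %[ae m]].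

Definition Lp_opnorm (p : \bar R) (H : (T -> R[i]) -> T -> R[i]) : \bar R :=
  ereal_sup [set Lp_norm p (H f) | f in [set f | Lp p f /\ (Lp_norm p f <= 1)%E]].

Definition Lp_bounded (p : \bar R) (H : (T -> R[i]) -> T -> R[i]) :=
  Lp_linear p H /\
  exists C : R, forall f, Lp p f -> (Lp_norm p (H f) <= C%:E * Lp_norm p f)%E.

End complex_functions.

(* 1/p, with 1/p = 0 for p = +oo *)
Definition inv_exponent (R : realType) (p : \bar R) : R :=
  if p is r%:E%E then r^-1 else 0.

Section hausdorff_operator.
Context (R : realType) (G : topGroupType) (K : groupClosed G).
Context d (Omega : measurableType d) (mu : {measure set Omega -> \bar R}).
Variables (Phi : Omega -> R[i]) (A : Omega -> G -> G).

Definition hausdorff_integrand (f : borel (coset_space K) -> R[i])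
    (u : Omega) (y : borel (coset_space K)) : R[i] :=
  Phi u * f (induced (A u) y).

(* Standing measurability requirement without which the integral defining
   [hausdorff_op] makes no sense, asked for the functions of L^p only; it holds
   in particular when (u, y) |-> induced (A u) y is measurable for the product
   sigma-algebra and Phi is measurable. *)
Definition measurable_integrand
    (lam : {measure set (borel (coset_space K)) -> \bar R}) (p : \bar R) :=
  forall f : borel (coset_space K) -> R[i], Lp lam p f ->
    cmeasurable (fun z : Omega * borel (coset_space K) =>
      hausdorff_integrand f z.1 z.2).

Definition hausdorff_op (f : borel (coset_space K) -> R[i])
    (y : borel (coset_space K)) : R[i] :=
  cintegral mu setT (fun u => hausdorff_integrand f u y).

Definition weight (modA : Omega -> R) (p : \bar R) (u : Omega) : R :=
  normc (Phi u) * modA u `^ (- inv_exponent p).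

Definition weighted_norm (modA : Omega -> R) (p : \bar R) : \bar R :=
  (\int[mu]_u (weight modA p u)%:E)%E.

End hausdorff_operator.

(* Main.v *)
(** Weil's formula gives lam(E) = nu(pi^-1(E)), so the map induced by A(u)
    multiplies lam by (mod A(u))^-1 and the L^p norm of y |-> f(A(u) y) is
    (mod A(u))^(-1/p) times that of f. The bound is then Minkowski's integral
    inequality. As neither mu nor lam is sigma-finite, Tonelli's theorem is
    applied to the restriction of mu to the sigma-finite set where the
    integrable weight |Phi(u)| (mod A(u))^(-1/p) is positive and to the
    restrictions of lam to sets of finite measure; inner regularity of nu
    makes lam semifinite, which suffices to recover integrals over G/K. *)

From HB Require Import structures.
Require Import Defs.
From mathcomp Require Import measurable_realfun ess_sup_inf ring.
Import Order.TTheory GRing.Theory Num.Theory.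
Import numFieldNormedType.Exports.
Local Open Scope classical_set_scope.
Local Open Scope ring_scope.

Set Implicit Arguments.
Unset Strict Implicit.
Unset Printing Implicit Defensive.

(** Duality, the usual route to Minkowski's inequality, is avoided. For a finite exponent, Hölder's
    inequality with the weight [w] bounds the [r]-th power of the integral at each [y], and a single
    exchange of integrals, needed only as an inequality, concludes; for [p = +oo] the exchange is
    applied to the set where the expected pointwise bound fails. When [m] is not sigma-finite,
    Tonelli's theorem does not supply the measurability of x |-> ||F(x, .)||_p; hence the inequality
    is stated with a measurable majorant [w x * N] of these norms, which for the Hausdorff operator
    is the weight times the norm of [f]. Two pointwise difficulties remain: the integral defining
    [H f] may diverge at some points, and the null set where two representatives of [f] differ is
    moved differently by each A(u). Both are settled by norm estimates: the bound for absolute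
    values gives convergence almost everywhere, and the bound for [f - g] gives independence of the
    representative. *)

Definition semifinite d (T : measurableType d) (R : realType)
    (m : {measure set T -> \bar R}) :=
  forall (E : set T) (c : \bar R), measurable E ->
    (forall B, measurable B -> B `<=` E -> (m B < +oo)%E -> (m B <= c)%E) ->
    (m E <= c)%E.

(** * Restricted measures, level sets and semifinite measures *)

Section integral_bounds.
Local Open Scope ereal_scope.
Context d (T : measurableType d) (R : realType).
Variable m : {measure set T -> \bar R}.
Implicit Types (D E : set T) (g : T -> \bar R).

Lemma mule_measure_le_integral E g (e : R) : measurable E ->
  measurable_fun E g -> (0 <= e)%R -> (forall x, E x -> e%:E <= g x) ->
  e%:E * m E <= \int[m]_(x in E) g x.
Proof.
move=> mE mg e0 eg; rewrite -(integral_cst m mE).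
exact: ge0_le_integral.
Qed.

Lemma integral_mrestr D (mD : measurable D) g : measurable_fun setT g ->
  (forall x, 0 <= g x) ->
  \int[mrestr m mD]_x g x = \int[m]_(x in D) g x.
Proof.
move=> mg g0; rewrite (@ge0_negligible_integral _ _ _ _ setT (~` D))//.
- rewrite setTD setCK; apply: eq_measure_integral => A mA AD.
  by rewrite /= /mrestr setIidl.
- exact: measurableC.
- by rewrite /= /mrestr setICl measure0.
Qed.

Lemma integral_mrestr_support D (mD : measurable D) g : measurable_fun setT g ->
  (forall x, 0 <= g x) -> (forall x, ~ D x -> g x = 0) ->
  \int[mrestr m mD]_x g x = \int[m]_x g x.
Proof.
move=> mg g0 gD; rewrite integral_mrestr// integral_mkcond.
apply: eq_integral => x _.
by rewrite patchE; case: ifPn => //; rewrite notin_setE => /gD ->.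
Qed.

Let level g n := [set x | (n.+1%:R^-1)%:E <= g x].

Let measurable_level g n : measurable_fun setT g -> measurable (level g n).
Proof.
by move=> mg; rewrite -[level g n]setTI; exact: emeasurable_fun_c_infty.
Qed.

Let nd_level g : nondecreasing_seq (level g).
Proof.
move=> i j ij; rewrite subsetEset => x /=; rewrite /level/=; apply: le_trans.
by rewrite lee_fin lef_pV2 ?posrE// ler_nat.
Qed.

Let bigcup_level g : [set x | 0 < g x] = \bigcup_n level g n.
Proof.
apply/seteqP; split=> [x /= gx|x [n _] /=]; last first.
  by apply: lt_le_trans; rewrite lte_fin invr_gt0.
case gxE : (g x) gx => [r|//|//]; last first.
  by exists 0%N => //=; rewrite /level/= gxE leey.
rewrite lte_fin => r0.
have [n _ /(_ n (leqnn n)) nr] := near_infty_natSinv_lt (PosNum r0).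
by exists n => //=; rewrite /level/= gxE lee_fin ltW.
Qed.

(** Chebyshev's inequality, for subsets [B] of a level set rather than for the level set itself:
    [semifinite_integral_le] only controls the integral of [g] over sets of finite measure. *)
Let measure_level_fin g n : measurable_fun setT g -> (forall x, 0 <= g x) ->
  forall B, measurable B -> B `<=` level g n ->
  m B <= n.+1%:R%:E * \int[m]_(x in B) g x.
Proof.
move=> mg g0 B mB Bg.
rewrite -lee_pdivrMl//; apply: mule_measure_le_integral => //.
exact: measurable_funTS.
Qed.

Lemma sigma_finite_support g : measurable_fun setT g -> (forall x, 0 <= g x) ->
  \int[m]_x g x < +oo -> sigma_finite [set x | 0 < g x] m.
Proof.
move=> mg g0 goo; rewrite bigcup_level; exists (level g) => // n; split.
  exact: measurable_level.
apply: le_lt_trans (measure_level_fin mg g0 _ (@subset_refl _ _)) _.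
  exact: measurable_level.
apply: lte_mul_pinfty => //; apply: le_lt_trans goo.
apply: ge0_subset_integral => //; exact: measurable_level.
Qed.

(* The superlevel sets [1/n <= g] have finite measure as soon as the integrals
   of g over the sets of finite measure are bounded, and they exhaust the
   support of g. *)
Lemma semifinite_integral_le g c : semifinite m ->
  measurable_fun setT g -> (forall x, 0 <= g x) ->
  (forall B, measurable B -> m B < +oo -> \int[m]_(x in B) g x <= c) ->
  \int[m]_x g x <= c.
Proof.
move=> sm mg g0 gc.
have [->|coo] := eqVneq c +oo; first by rewrite leey.
(* Chebyshev's inequality bounds the subsets of finite measure of a level set uniformly;
   semifiniteness turns this into a bound for the level set, whose measure could a priori be
   infinite. *)
have level_fin n : m (level g n) < +oo.
  apply: (@le_lt_trans _ _ (n.+1%:R%:E * c)).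
    apply: sm => [|B mB Bg Boo]; first exact: measurable_level.
    apply: le_trans (measure_level_fin mg g0 mB Bg) _.
    by apply: lee_wpmul2l => //; exact: gc.
  by rewrite lte_mul_pinfty// ltey.
have -> : \int[m]_x g x = \int[m]_(x in \bigcup_n level g n) g x.
  rewrite -bigcup_level [RHS]integral_mkcond; apply: eq_integral => x _.
  rewrite patchE; case: ifPn => //; rewrite notin_setE /= => /negP.
  by rewrite -leNgt => gx; apply/eqP; rewrite eq_le gx g0.
have := @ge0_nondecreasing_set_cvg_integral _ _ _ (level g) g m (@nd_level g).
move=> /(_ (fun n => measurable_level n mg)) cvg_level.
apply: cvge_le (cvg_level _ _).
- by apply: nearW => n; apply: gc => //; exact: measurable_level.
- by move=> n; exact: measurable_funTS.
- by move=> n x _.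
Qed.

End integral_bounds.

(** On a set [B] of finite measure Tonelli's theorem holds exactly, and the integral of f(x, .) over
    [B] is at most [c x]; semifiniteness then removes [B]. The measurable [c] stands in for the full
    integral over [Y], which need not be measurable in [x]. *)
Lemma semifinite_tonelli_le d1 d2 (X : measurableType d1) (Y : measurableType d2)
    (R : realType) (mu : {sigma_finite_measure set X -> \bar R})
    (m : {measure set Y -> \bar R}) (f : X * Y -> \bar R) (c : X -> \bar R) :
  semifinite m -> measurable_fun setT f -> (forall z, 0 <= f z)%E ->
  measurable_fun setT c ->
  (forall x, \int[m]_y f (x, y) <= c x)%E ->
  (\int[m]_y \int[mu]_x f (x, y) <= \int[mu]_x c x)%E.
Proof.
move=> sm mf f0 mc fc.
have mG : measurable_fun setT (fun y => \int[mu]_x f (x, y))%E.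
  exact: measurable_fun_fubini_tonelli_G.
have G0 y : (0 <= \int[mu]_x f (x, y))%E by apply: integral_ge0 => x _; exact: f0.
apply: semifinite_integral_le => // B mB Boo.
rewrite -integral_mrestr//.
rewrite -(fubini_tonelli (m2 := mfrestr mB Boo))//.
have c0 x : (0 <= c x)%E.
  by apply: le_trans (fc x); apply: integral_ge0 => y _; exact: f0.
apply: ge0_le_integral => //.
- by move=> x _; apply: integral_ge0 => y _; exact: f0.
- exact: (measurable_fun_fubini_tonelli_F (m2 := mfrestr mB Boo)).
move=> x _; apply: le_trans (fc x).
have mfx : measurable_fun setT (fun y => f (x, y)).
  exact: (measurableT_comp mf (pair1_measurable x)).
rewrite [leLHS]integral_mrestr//.
exact: ge0_subset_integral.
Qed.

(** * Minkowski's integral inequality over a sigma-finite measure *)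

Section minkowski.
Local Open Scope ereal_scope.
Context d1 d2 (X : measurableType d1) (Y : measurableType d2) (R : realType).

(* Hoelder's inequality for the factorization
   [f = w^(1/q) * (w^(-1/q) f)], where q is conjugate to r. *)
Lemma poweR_integral_le (mu : {measure set X -> \bar R}) (w f : X -> R) (r : R) :
  (1 <= r)%R -> measurable_fun setT w -> measurable_fun setT f ->
  (forall x, 0 <= w x)%R -> (forall x, 0 <= f x)%R ->
  (forall x, w x = 0 -> f x = 0)%R ->
  (\int[mu]_x (f x)%:E) `^ r <=
  (\int[mu]_x (w x)%:E) `^ (r - 1) * \int[mu]_x (w x `^ (1 - r) * f x `^ r)%:E.
Proof.
move=> r1 mw mf w0 f0 wf0.
(* For [r = 1] the conjugate exponent is infinite. Both sides are then the integral of [f], since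
   every zeroth power is 1, even that of 0. *)
have [<-|r_neq1] := eqVneq 1%R r.
  rewrite subrr poweRe0 mul1e poweRe1; last first.
    by apply: integral_ge0 => x _; rewrite lee_fin.
  under [leRHS]eq_integral do rewrite powRr0 mul1r powRr1//.
  exact: lexx.
have {r1 r_neq1}r1 : (1 < r)%R by rewrite lt_neqAle r_neq1.
have r0 : (0 < r)%R by apply: lt_trans r1.
have r10 : (0 < r - 1)%R by rewrite subr_gt0.
pose q := (r / (r - 1))%R.
have q0 : (0 < q)%R by rewrite divr_gt0.
have qr : (q^-1 + r^-1 = 1)%R.
  by rewrite invf_div -[X in (_ + X)%R]mul1r -mulrDl subrK divff// gt_eqF.
pose a x := (w x `^ q^-1)%R.
pose b x := (w x `^ (- q^-1) * f x)%R.
have ma : measurable_fun setT a by exact: (measurableT_comp (measurable_powR _)).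
have mb : measurable_fun setT b.
  by apply: measurable_funM => //; exact: (measurableT_comp (measurable_powR _)).
(* [powR] sends 0 to 0 for any nonzero exponent, so the product is 0 where [w] vanishes; this is
   where [f] must vanish with [w]. *)
have fab x : f x = (a x * b x)%R.
  rewrite /a /b; have [/wf0 ->|wx] := eqVneq (w x) 0%R; first by rewrite !mulr0.
  by rewrite mulrA powRN divff ?mul1r// powR_eq0 (negbTE wx).
have := hoelder mu ma mb q0 r0 qr.
rewrite Lnorm1; under eq_integral do rewrite /= -fab ger0_norm//.
move=> ab.
apply: (@le_trans _ _
  (('N[mu]_q%:E[EFin \o a] * 'N[mu]_r%:E[EFin \o b]) `^ r)).
  apply: gt0_ler_poweR => //; first exact: ltW.
  - by rewrite in_itv/= leey andbT; apply: integral_ge0 => x _; rewrite lee_fin.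
  - by rewrite in_itv/= leey andbT; rewrite mule_ge0 ?Lnorm_ge0.
rewrite poweRM ?Lnorm_ge0//; rewrite (@poweR_Lnorm _ _ _ _ (EFin \o b)) ?gt_eqF//.
apply: lee_pmul => //; first exact: poweR_ge0.
- by apply: integral_ge0 => x _; exact: poweR_ge0.
- rewrite unlock -poweRrM.
  have -> : (q^-1 * r = r - 1)%R by rewrite invf_div -mulrA mulVf ?mulr1// gt_eqF.
  rewrite le_eqVlt; apply/orP; left; apply/eqP; congr (_ `^ _).
  apply: eq_integral => x _ /=; rewrite ger0_norm ?powR_ge0//.
  by rewrite /a -powRrM mulVf ?gt_eqF// powRr1.
- rewrite le_eqVlt; apply/orP; left; apply/eqP.
  apply: eq_integral => x _ /=; rewrite ger0_norm; last by rewrite mulr_ge0// powR_ge0.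
  rewrite /b powRM// ?powR_ge0// -powRrM; congr (_ `^ _ * _)%:E.
  by rewrite invf_div mulNr -mulrA mulVf ?mulr1 ?opprB// gt_eqF.
Qed.

Context (mu : {sigma_finite_measure set X -> \bar R}).
Context (m : {measure set Y -> \bar R}).

(** With W the integral of [w], Hölder's inequality bounds the [r]-th power of the inner integral by
    W^(r-1) times the integral in [x] of w^(1-r) F^r. After the exchange of integrals the hypothesis
    on norms gives w^(1-r) (w N)^r = w N^r, hence the total W^(r-1) W N^r = (W N)^r. *)
Lemma minkowski_integral_fin (F : X * Y -> R) (w : X -> R) (N r : R) :
  semifinite m -> (1 <= r)%R -> measurable_fun setT F -> (forall z, 0 <= F z)%R ->
  measurable_fun setT w -> (forall x, 0 <= w x)%R ->
  \int[mu]_x (w x)%:E < +oo -> (0 <= N)%R ->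
  (forall x y, w x = 0 -> F (x, y) = 0)%R ->
  (forall x, 'N[m]_r%:E[(fun y => (F (x, y))%:E)] <= (w x * N)%:E) ->
  'N[m]_r%:E[(fun y => \int[mu]_x (F (x, y))%:E)] <= \int[mu]_x (w x)%:E * N%:E.
Proof.
move=> sm r1 mF F0 mw w0 woo N0 wF FN.
have r0 : (0 < r)%R by apply: lt_le_trans r1.
set W := \int[mu]_x (w x)%:E.
have W0 : 0 <= W by apply: integral_ge0 => x _; rewrite lee_fin.
pose h y := \int[mu]_x (F (x, y))%:E.
have h0 y : 0 <= h y by apply: integral_ge0 => x _; rewrite lee_fin.
have mEF : measurable_fun setT (EFin \o F) by exact/measurable_EFinP.
have mh : measurable_fun setT h.
  by apply: (measurable_fun_fubini_tonelli_G (EFin \o F)) => //.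
pose G z := (w z.1 `^ (1 - r) * F z `^ r)%R.
have G0 z : (0 <= G z)%R by rewrite mulr_ge0 ?powR_ge0.
have mG : measurable_fun setT G.
  apply: measurable_funM; last exact: (measurableT_comp (measurable_powR _)).
  apply: (measurableT_comp (measurable_powR _)).
  exact: measurableT_comp mw measurable_fst.
have FNr x : \int[m]_y (F (x, y) `^ r)%:E <= (w x * N)%:E `^ r.
  have -> : \int[m]_y (F (x, y) `^ r)%:E = 'N[m]_r%:E[(fun y => (F (x, y))%:E)] `^ r.
    rewrite poweR_Lnorm ?gt_eqF//; apply: eq_integral => y _ /=.
    by rewrite ger0_norm.
  apply: gt0_ler_poweR => //; first exact: ltW.
  - rewrite in_itv/= leey andbT. exact: Lnorm_ge0.
  - by rewrite in_itv/= leey andbT lee_fin mulr_ge0.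
have hr : \int[m]_y (`|h y| `^ r) <= (W * N%:E) `^ r.
  apply: (@le_trans _ _ (\int[m]_y (W `^ (r - 1) * \int[mu]_x (G (x, y))%:E))).
    have mWG : measurable_fun setT (fun y => W `^ (r - 1) * \int[mu]_x (G (x, y))%:E).
      apply: emeasurable_funM => //.
      apply: (measurable_fun_fubini_tonelli_G (EFin \o G)) => //.
      exact/measurable_EFinP.
    apply: ge0_le_integral => //.
    - by move=> y _; exact: poweR_ge0.
    - apply: (measurableT_comp (measurable_poweR _)); exact: measurableT_comp.
    - move=> y _; rewrite gee0_abs//; apply: poweR_integral_le => //.
        exact: (measurableT_comp mF (pair2_measurable y)).
      by move=> x; exact: wF.
  rewrite ge0_integralZl//; last 3 first.
  - apply: (measurable_fun_fubini_tonelli_G (EFin \o G)) => //.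
    exact/measurable_EFinP.
  - by move=> y _; apply: integral_ge0 => x _; rewrite lee_fin.
  - exact: poweR_ge0.
  apply: (@le_trans _ _ (W `^ (r - 1) * \int[mu]_x (w x * N `^ r)%:E)).
    apply: lee_wpmul2l; first exact: poweR_ge0.
    apply: (@semifinite_tonelli_le _ _ _ _ _ mu m (EFin \o G)) => //.
    - exact/measurable_EFinP.
    - by apply/measurable_EFinP; exact: measurable_funM.
    move=> x; under eq_integral do rewrite /= /G /= EFinM.
    have mFx : measurable_fun setT (fun y => F (x, y)).
      exact: (measurableT_comp mF (pair1_measurable x)).
    rewrite ge0_integralZl//; last 3 first.
    - by apply/measurable_EFinP; exact: (measurableT_comp (measurable_powR _)).
    - by move=> y _; rewrite lee_fin powR_ge0.
    - by rewrite lee_fin powR_ge0.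
    apply: (@le_trans _ _ ((w x `^ (1 - r))%:E * ((w x * N)%:E `^ r))).
      by apply: lee_wpmul2l; [rewrite lee_fin powR_ge0|exact: FNr].
    rewrite poweR_EFin -EFinM lee_fin powRM// mulrA.
    rewrite le_eqVlt; apply/orP; left; apply/eqP; congr (_ * _)%R.
    have [->|wx] := eqVneq (w x) 0%R; first by rewrite (@powR0 _ r) ?gt_eqF// mulr0.
    by rewrite -powRD ?wx ?implybT// subrK powRr1.
  under eq_integral do rewrite EFinM.
  rewrite ge0_integralZr//; last 3 first.
  - exact/measurable_EFinP.
  - by move=> x _; rewrite lee_fin.
  - by rewrite lee_fin powR_ge0.
  rewrite -/W muleA poweRM// poweR_EFin.
  apply: lee_wpmul2r; first by rewrite lee_fin powR_ge0.
  have Wfin : W \is a fin_num by rewrite ge0_fin_numE.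
  rewrite -[W]fineK// poweR_EFin -EFinM poweR_EFin lee_fin.
  have [->|W_neq0] := eqVneq (fine W) 0%R; first by rewrite mulr0 powR_ge0.
  rewrite -[X in (_ * X)%R]powRr1; last exact: fine_ge0.
  by rewrite -powRD ?W_neq0 ?implybT// subrK.
rewrite unlock /=.
have -> : W * N%:E = ((W * N%:E) `^ r) `^ r^-1.
  by rewrite -poweRrM divff ?gt_eqF// poweRe1// mule_ge0.
apply: gt0_ler_poweR => //.
- by rewrite invr_ge0 ltW.
- by rewrite in_itv/= leey andbT integral_ge0// => y _; exact: poweR_ge0.
- by rewrite in_itv/= leey andbT poweR_ge0.
Qed.

(** Each section over [x] of the set [B] where [F] exceeds [w x * N] is null. By the exchange of
    integrals with majorant 0, almost every section over [y] is null too, and for such [y] the bound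
    can be integrated in [x]. *)
Lemma minkowski_integral_pinfty (F : X * Y -> R) (w : X -> R) (N : R) :
  semifinite m -> measurable_fun setT F -> (forall z, 0 <= F z)%R ->
  measurable_fun setT w -> (forall x, 0 <= w x)%R -> (0 <= N)%R ->
  (forall x, 'N[m]_+oo[(fun y => (F (x, y))%:E)] <= (w x * N)%:E) ->
  'N[m]_+oo[(fun y => \int[mu]_x (F (x, y))%:E)] <= \int[mu]_x (w x)%:E * N%:E.
Proof.
move=> sm mF F0 mw w0 N0 FN; rewrite unlock /=.
(* The norm for [+oo] is set to 0 when the whole space is null, so the essential supremum only
   appears on a space of positive measure. *)
case: ifPn => [mT|_]; last first.
  by rewrite mule_ge0 ?lee_fin//; apply: integral_ge0 => x _; rewrite lee_fin.
apply/ess_supP.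
have mwN : measurable_fun setT (fun z : X * Y => (w z.1 * N)%R).
  by apply: measurable_funM => //; exact: measurableT_comp mw measurable_fst.
pose B := [set z | (w z.1 * N < F z)%R].
have mB : measurable B.
  rewrite -[B]setTI.
  exact: (measurable_fun_ltr mwN mF measurableT (Y := [set true])).
have mf : measurable_fun setT (fun z => (\1_B z)%:E : \bar R).
  exact/measurable_EFinP/measurable_indic.
have f0 z : 0 <= (\1_B z)%:E :> \bar R by rewrite lee_fin.
have fx x : \int[m]_y (\1_B (x, y))%:E <= (cst 0 : X -> \bar R) x.
  have := FN x; rewrite unlock /= mT => /ess_supP FNx.
  rewrite (@ae_eq_integral _ _ _ m setT (cst 0)) ?integral0//.
    exact: (measurableT_comp mf (pair1_measurable x)).
  apply: filterS FNx => y /=; rewrite ger0_norm// lee_fin => FNxy _.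
  by rewrite indicE memNset// /B/=; apply/negP; rewrite -leNgt.
have := semifinite_tonelli_le mu sm mf f0 (measurable_cst _) fx.
rewrite integral0 => I0.
have mI : measurable_fun setT (fun y => \int[mu]_x (\1_B (x, y))%:E).
  exact: (measurable_fun_fubini_tonelli_G (fun z => (\1_B z)%:E)).
have I_ge0 y : 0 <= \int[mu]_x (\1_B (x, y))%:E by apply: integral_ge0.
have : ae_eq m setT (fun y => \int[mu]_x (\1_B (x, y))%:E) (cst 0).
  apply/ae_eq_integral_abs => //; under eq_integral do rewrite gee0_abs//.
  by apply/eqP; rewrite eq_le I0/=; exact: integral_ge0.
apply: filterS => y /(_ I) /= Iy; rewrite gee0_abs; last first.
  by apply: integral_ge0 => x _; rewrite lee_fin.
have mBy : measurable_fun setT (fun x => (\1_B (x, y))%:E : \bar R).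
  exact: (measurableT_comp mf (pair2_measurable y)).
have : ae_eq mu setT (fun x => (\1_B (x, y))%:E : \bar R) (cst 0).
  by apply/ae_eq_integral_abs => //; under eq_integral do rewrite gee0_abs//.
move=> By; rewrite -ge0_integralZr//; last 2 first.
- exact/measurable_EFinP.
- by move=> x _; rewrite lee_fin.
apply: ae_ge0_le_integral => //.
- by move=> x _; rewrite lee_fin.
- by apply/measurable_EFinP; exact: (measurableT_comp mF (pair2_measurable y)).
- by move=> x _; rewrite mule_ge0// lee_fin.
- by apply: emeasurable_funM => //; exact/measurable_EFinP.
apply: filterS By => x /(_ I) /= Bxy _; rewrite -EFinM lee_fin leNgt.
apply/negP => wF; move: Bxy; rewrite indicE mem_set//.
by case => /eqP; rewrite oner_eq0.
Qed.

Lemma minkowski_integral_sigma_finite (F : X * Y -> R) (w : X -> R) (N : R) (p : \bar R) :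
  semifinite m -> 1 <= p -> measurable_fun setT F -> (forall z, 0 <= F z)%R ->
  measurable_fun setT w -> (forall x, 0 <= w x)%R ->
  \int[mu]_x (w x)%:E < +oo -> (0 <= N)%R ->
  (forall x y, w x = 0 -> F (x, y) = 0)%R ->
  (forall x, 'N[m]_p[(fun y => (F (x, y))%:E)] <= (w x * N)%:E) ->
  'N[m]_p[(fun y => \int[mu]_x (F (x, y))%:E)] <= \int[mu]_x (w x)%:E * N%:E.
Proof.
case: p => [r| |//] sm p1 mF F0 mw w0 woo N0 wF FN.
- exact: minkowski_integral_fin.
- exact: minkowski_integral_pinfty.
Qed.

End minkowski.

(** * From sigma-finite measures to arbitrary ones, by restriction to the support of an integrable
    weight *)

Section sigma_finite_restriction.
Context d (T : measurableType d) (R : realType).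
Variables (mu : {measure set T -> \bar R}) (D : set T).

(** The sigma-finiteness proof is an argument, so that the sigma-finite structure can be inferred
    from the term itself. *)
Definition sfrestr (mD : measurable D) & sigma_finite D mu := mrestr mu mD.

Variables (mD : measurable D) (sD : sigma_finite D mu).

HB.instance Definition _ := Measure.on (sfrestr mD sD).

Let sfrestr_sigma_finite : sigma_finite setT (sfrestr mD sD).
Proof.
have [F DF Foo] := sD.
(* The restricted measure ignores the complement of [D], so adding it to each piece covers the whole
   space without changing any measure. *)
exists (fun n => F n `|` ~` D) => [|n].
  rewrite bigcupUl -?DF; last by exists 0%N.
  by rewrite setUv.
have [mFn Fnoo] := Foo n; split; first by apply: measurableU => //; exact: measurableC.
by rewrite /sfrestr /mrestr setIUl setICl setU0 setIidl// DF; exact: bigcup_sup.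
Qed.

HB.instance Definition _ :=
  Measure_isSigmaFinite.Build _ _ _ (sfrestr mD sD) sfrestr_sigma_finite.

End sigma_finite_restriction.

Section sigma_finite_support.
Local Open Scope ereal_scope.
Context d1 d2 (X : measurableType d1) (Y : measurableType d2) (R : realType).
Context (mu : {measure set X -> \bar R}) (w : X -> R).
Hypotheses (mw : measurable_fun setT w) (w0 : forall x, (0 <= w x)%R).
Hypothesis woo : \int[mu]_x (w x)%:E < +oo.

Let S := [set x | 0 < (w x)%:E].

Let mS : measurable S.
Proof.
rewrite -[S]setTI; apply: emeasurable_fun_o_infty => //.
exact/measurable_EFinP.
Qed.

Let sS : sigma_finite S mu.
Proof.
apply: sigma_finite_support => //; first exact/measurable_EFinP.
Qed.

Let w_eq0 x : ~ S x -> w x = 0%R.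
Proof.
by move=> /negP; rewrite -leNgt lee_fin => wx; apply/eqP; rewrite eq_le wx w0.
Qed.

(** The integral only sees the sigma-finite set where [w] is positive, and there the measurability
    part of Tonelli's theorem applies. No integrability in [x] is assumed: the extended integral is
    always the difference of those of the positive and negative parts. *)
Lemma measurable_fun_integral_support (f : X * Y -> \bar R) :
  measurable_fun setT f -> (forall x y, w x = 0%R -> f (x, y) = 0) ->
  measurable_fun setT (fun y => \int[mu]_x f (x, y)).
Proof.
have ge0 (g : X * Y -> \bar R) : measurable_fun setT g -> (forall z, 0 <= g z) ->
    (forall x y, w x = 0%R -> g (x, y) = 0) ->
    measurable_fun setT (fun y => \int[mu]_x g (x, y)).
  move=> mg g0 gw.
  rewrite [X in measurable_fun _ X](_ : _ = fubini_G (sfrestr mS sS) g).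
    exact: measurable_fun_fubini_tonelli_G.
  apply/funext => y; rewrite /fubini_G; apply/esym.
  apply: (integral_mrestr_support mu mS) => //.
    exact: (measurableT_comp mg (pair2_measurable y)).
  by move=> x /w_eq0; exact: gw.
move=> mf fw.
rewrite [X in measurable_fun _ X](_ : _ =
    (fun y => \int[mu]_x f^\+ (x, y)) \- (fun y => \int[mu]_x f^\- (x, y))).
  apply: emeasurable_funB; apply: ge0.
  - exact: measurable_funepos.
  - by [].
  - by move=> x y /fw fxy; rewrite funeposE fxy maxxx.
  - exact: measurable_funeneg.
  - by [].
  - by move=> x y /fw fxy; rewrite funenegE fxy oppe0 maxxx.
apply/funext => y /=; rewrite [LHS]integralE.
by congr (_ - _); apply: eq_integral => x _; rewrite ?funeposE ?funenegE.
Qed.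

Lemma minkowski_integral (m : {measure set Y -> \bar R}) (F : X * Y -> R)
    (N : R) (p : \bar R) :
  semifinite m -> 1 <= p -> measurable_fun setT F -> (forall z, 0 <= F z)%R ->
  (0 <= N)%R ->
  (forall x y, w x = 0 -> F (x, y) = 0)%R ->
  (forall x, 'N[m]_p[(fun y => (F (x, y))%:E)] <= (w x * N)%:E) ->
  'N[m]_p[(fun y => \int[mu]_x (F (x, y))%:E)] <= \int[mu]_x (w x)%:E * N%:E.
Proof.
move=> sm p1 mF F0 N0 wF FN.
have restrE (g : X -> R) : measurable_fun setT g -> (forall x, 0 <= g x)%R ->
    (forall x, w x = 0 -> g x = 0)%R ->
    \int[sfrestr mS sS]_x (g x)%:E = \int[mu]_x (g x)%:E.
  move=> mg g0 gw; apply: (integral_mrestr_support mu mS) => //.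
    exact/measurable_EFinP.
  by move=> x /w_eq0 /gw ->.
have -> : (fun y => \int[mu]_x (F (x, y))%:E) =
    (fun y => \int[sfrestr mS sS]_x (F (x, y))%:E).
  apply/funext => y; rewrite restrE//.
    exact: (measurableT_comp mF (pair2_measurable y)).
  by move=> x; exact: wF.
by rewrite -restrE//; apply: minkowski_integral_sigma_finite => //; rewrite restrE.
Qed.

End sigma_finite_support.

(** * Monotonicity of the norms, and finiteness almost everywhere *)

Section Lnorm_extra.
Local Open Scope ereal_scope.
Context d (T : measurableType d) (R : realType).
Variable m : {measure set T -> \bar R}.
Implicit Types (f g : T -> \bar R) (p : \bar R).

Lemma ae_le_Lnorm p f g : 0 < p -> measurable_fun setT f ->
  measurable_fun setT g -> {ae m, forall x, `|f x| <= `|g x|} ->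
  'N[m]_p[f] <= 'N[m]_p[g].
Proof.
case: p => [r| |//] p0 mf mg fg; rewrite unlock /=.
  rewrite lte_fin in p0.
  have mpow (h : T -> \bar R) : measurable_fun setT h ->
      measurable_fun setT (fun x => `|h x| `^ r).
    move=> mh; apply: (@measurableT_comp _ _ _ _ _ _ (fun x => x `^ r)).
      exact: measurable_poweR.
    exact: measurableT_comp.
  apply: gt0_ler_poweR.
  - by rewrite invr_ge0 ltW.
  - by rewrite in_itv/= leey andbT integral_ge0// => x _; exact: poweR_ge0.
  - by rewrite in_itv/= leey andbT integral_ge0// => x _; exact: poweR_ge0.
  apply: ae_ge0_le_integral => //.
  - by move=> x _; exact: poweR_ge0.
  - exact: mpow.
  - by move=> x _; exact: poweR_ge0.
  - exact: mpow.
  apply: filterS fg => x fgx _; apply: gt0_ler_poweR => //.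
  - exact: ltW.
  - by rewrite in_itv/= leey andbT.
  - by rewrite in_itv/= leey andbT.
by case: ifPn => // _; exact: le_ess_sup.
Qed.

Lemma Lnorm_lty_ae p f : 0 < p -> measurable_fun setT f ->
  'N[m]_p[f] < +oo -> {ae m, forall x, `|f x| < +oo}.
Proof.
case: p => [r| |//] p0 mf; rewrite ?unlock /=.
  rewrite lte_fin in p0 => foo.
  have : m.-integrable setT (fun x => `|f x| `^ r).
    apply/integrableP; split.
      apply: (@measurableT_comp _ _ _ _ _ _ (fun x => x `^ r)).
      exact: measurable_poweR.
    exact: measurableT_comp.
    under eq_integral do rewrite gee0_abs ?poweR_ge0//.
    rewrite ltNge leye_eq; apply/negP => /eqP Ioo; move: foo.
    by rewrite Ioo poweRyr ?invr_eq0 ?gt_eqF// ltxx.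
  move/(integrable_ae measurableT); apply: filterS => x /(_ I).
  rewrite [in X in _ -> X]ltNge leye_eq => fx; apply/negP => /eqP fxoo; move: fx.
  by rewrite fxoo poweRyr ?gt_eqF.
case: ifPn => [_ foo|].
  by apply: filterS (ess_sup_ge m (abse \o f)) => x /le_lt_trans; apply.
(* Here the finite norm is only the default value 0, but the whole space is null and can serve as
   exceptional set. *)
rewrite -leNgt => m0 _; exists setT; split => //.
by apply/eqP; rewrite eq_le m0/=.
Qed.

End Lnorm_extra.

(** * Integrals of complex-valued functions *)

Section complex_integral.
Context d (T : measurableType d) (R : realType).
Variable m : {measure set T -> \bar R}.
Implicit Types (f g : T -> R[i]).

Lemma normc_ge0 (z : R[i]) : 0 <= normc z.
Proof. by case: z => a b; exact: sqrtr_ge0. Qed.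

Lemma normcE (z : R[i]) : normc z = Num.sqrt (complex.Re z ^+ 2 + complex.Im z ^+ 2).
Proof. by case: z. Qed.

Lemma normc_sqr (z : R[i]) : normc z ^+ 2 = complex.Re z ^+ 2 + complex.Im z ^+ 2.
Proof. by rewrite normcE sqr_sqrtr// addr_ge0// sqr_ge0. Qed.

Lemma normr_Re_le_normc (z : R[i]) : `|complex.Re z| <= normc z.
Proof. by rewrite normcE -sqrtr_sqr ler_wsqrtr// lerDl sqr_ge0. Qed.

Lemma normr_Im_le_normc (z : R[i]) : `|complex.Im z| <= normc z.
Proof. by rewrite normcE -sqrtr_sqr ler_wsqrtr// lerDr sqr_ge0. Qed.

(** The Cauchy-Schwarz inequality in the plane, by Lagrange's identity. *)
Lemma dot_le_normcM (z w : R[i]) :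
  complex.Re z * complex.Re w + complex.Im z * complex.Im w <= normc z * normc w.
Proof.
apply: le_trans (ler_norm _) _.
rewrite -(@ler_pXn2r _ 2)// ?nnegrE ?mulr_ge0 ?normc_ge0//.
rewrite real_normK ?num_real// exprMn !normc_sqr.
move: (complex.Re z) (complex.Im z) (complex.Re w) (complex.Im w) => a b x y.
have -> : (a ^+ 2 + b ^+ 2) * (x ^+ 2 + y ^+ 2) =
    (a * x + b * y) ^+ 2 + (a * y - b * x) ^+ 2 by ring.
by rewrite lerDl sqr_ge0.
Qed.

Lemma measurable_normc f : cmeasurable f ->
  measurable_fun setT (fun x => normc (f x)).
Proof.
move=> [mr mi].
have -> : (fun x => normc (f x)) =
    (fun x => (complex.Re (f x) ^+ 2 + complex.Im (f x) ^+ 2) `^ 2^-1).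
  by apply/funext => x /=; rewrite normcE powR12_sqrt// addr_ge0// sqr_ge0.
apply: (measurableT_comp (measurable_powR _)).
by apply: measurable_funD; exact: measurable_funX.
Qed.

Lemma normc_cintegrable f : cmeasurable f ->
  (\int[m]_x (normc (f x))%:E < +oo)%E -> cintegrable m setT f.
Proof.
move=> mf foo; have [mr mi] := mf.
have nf : m.-integrable setT (fun x => (normc (f x))%:E).
  apply/integrableP; split; first by apply/measurable_EFinP; exact: measurable_normc.
  by under eq_integral do rewrite gee0_abs ?lee_fin ?normc_ge0//.
split; apply: le_integrable nf => //.
- exact/measurable_EFinP.
- move=> x _ /=; rewrite lee_fin (ger0_norm (normc_ge0 _)); exact: normr_Re_le_normc.
- exact/measurable_EFinP.
- move=> x _ /=; rewrite lee_fin (ger0_norm (normc_ge0 _)); exact: normr_Im_le_normc.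
Qed.

(* With z the integral, [|z|^2] is the integral of the pointwise scalar product
   of z and f, which is at most [|z| |f|]. *)
Lemma normc_cintegral_le f : cmeasurable f ->
  ((normc (cintegral m setT f))%:E <= \int[m]_x (normc (f x))%:E)%E.
Proof.
move=> mf.
have [foo|] := ltP (\int[m]_x (normc (f x))%:E)%E +oo%E; last first.
  by rewrite leye_eq => /eqP ->; rewrite leey.
have [ir ii] := normc_cintegrable mf foo.
have nf : m.-integrable setT (fun x => (normc (f x))%:E).
  apply/integrableP; split; first by apply/measurable_EFinP; exact: measurable_normc.
  by under eq_integral do rewrite gee0_abs ?lee_fin ?normc_ge0//.
set z := cintegral m setT f.
have -> : (\int[m]_x (normc (f x))%:E = (\int[m]_x normc (f x))%:E)%E.
  rewrite /Rintegral fineK//; exact: integrable_fin_num.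
rewrite lee_fin.
have [->|z0] := eqVneq (normc z) 0.
  by apply: Rintegral_ge0 => x _; exact: normc_ge0.
have {}z0 : 0 < normc z by rewrite lt_neqAle eq_sym z0 normc_ge0.
rewrite -(ler_pM2l z0) -expr2 normc_sqr.
have irz : m.-integrable setT (EFin \o (fun x => complex.Re z * complex.Re (f x))).
  exact: (integrableZl measurableT _ ir).
have iiz : m.-integrable setT (EFin \o (fun x => complex.Im z * complex.Im (f x))).
  exact: (integrableZl measurableT _ ii).
have inz : m.-integrable setT (EFin \o (fun x => normc z * normc (f x))).
  exact: (integrableZl measurableT _ nf).
(* In each of the two squares one copy of [z] is unfolded into an integral and the other stays a
   constant factor; the second occurrence number is counted after the first unfolding. *)
rewrite -RintegralZl// !expr2 {2}/z {3}/z /= -!RintegralZl// -RintegralD//.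
apply: le_Rintegral => //; first exact: (integrableD measurableT irz iiz).
by move=> x _; exact: (dot_le_normcM z (f x)).
Qed.

Lemma cintegral_linear (a : R[i]) f g :
  cintegrable m setT f -> cintegrable m setT g ->
  cintegral m setT (fun x => a * f x + g x) =
  a * cintegral m setT f + cintegral m setT g.
Proof.
case: a => a b [fr fi] [gr gi]; rewrite /cintegral.
have ReE x : complex.Re (Complex a b * f x + g x) =
    a * complex.Re (f x) - b * complex.Im (f x) + complex.Re (g x).
  by case: (f x) (g x) => ? ? [? ?].
have ImE x : complex.Im (Complex a b * f x + g x) =
    a * complex.Im (f x) + b * complex.Re (f x) + complex.Im (g x).
  by case: (f x) (g x) => ? ? [? ?].
under eq_Rintegral do rewrite ReE.
under [X in Complex _ X]eq_Rintegral do rewrite ImE.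
have i (c : R) h : m.-integrable setT (EFin \o h) ->
    m.-integrable setT (EFin \o (fun x => c * h x)).
  by move=> ih; exact: (integrableZl measurableT _ ih).
rewrite RintegralD//; [|exact: (integrableB measurableT (i _ _ fr) (i _ _ fi))].
rewrite RintegralB//; try exact: i.
rewrite RintegralD//; [|exact: (integrableD measurableT (i _ _ fi) (i _ _ fr))].
rewrite RintegralD//; try exact: i.
by rewrite !RintegralZl.
Qed.

End complex_integral.

(** * Borel structure of the coset space and induced maps *)

Section borel_maps.
Implicit Types S T : ptopologicalType.

Lemma borel_open T (U : set T) : open U -> measurable (U : set (borel T)).
Proof. exact: sub_sigma_algebra. Qed.

Lemma borel_closed T (C : set T) : closed C -> measurable (C : set (borel T)).
Proof.
move=> cC; rewrite -[C]setCK; apply: measurableC; apply: borel_open.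
exact: closed_openC.
Qed.

Lemma continuous_borel_measurable S T (f : S -> T) : continuous f ->
  measurable_fun setT (f : borel S -> borel T).
Proof.
move=> /continuousP cf.
apply: (@measurability _ _ (borel S) (borel T) setT f (@open T)) => //.
by move=> _ [U oU <-]; rewrite setTI; apply: borel_open; exact: cf.
Qed.

End borel_maps.

Section cosets.
Context (G : topGroupType) (K : groupClosed G).
Local Notation pi := (@coset_pi G K).

Lemma coset_pi_eqP (x y : G) : pi x = pi y <-> (x^-1 * y)%g \in K.
Proof. by split=> [/eqquotP|xy]; [|apply/eqquotP]. Qed.

Lemma repr_coset_piP (x : G) : exists2 k, k \in K & repr (pi x) = (x * k)%g.
Proof.
exists (x^-1 * repr (pi x))%g; last by rewrite mulgA mulgV mul1g.
by apply/coset_pi_eqP; rewrite /coset_pi reprK.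
Qed.

Lemma coset_pi_mulr (x k : G) : k \in K -> pi (x * k)%g = pi x.
Proof.
move=> kK; apply/esym/coset_pi_eqP.
by rewrite mulgA mulVg mul1g.
Qed.

Lemma coset_pi_repr (y : coset_space K) : pi (repr y) = y.
Proof. by rewrite /coset_pi reprK. Qed.

Lemma coset_pi_continuous : continuous pi.
Proof. exact: pi_continuous. Qed.

Lemma measurable_coset_pi :
  measurable_fun setT (pi : borel G -> borel (coset_space K)).
Proof. apply: continuous_borel_measurable; exact: coset_pi_continuous. Qed.

Lemma measurable_preimage_coset_pi (E : set (borel (coset_space K))) :
  measurable E -> measurable (pi @^-1` E : set (borel G)).
Proof.
by move=> mE; rewrite -[X in measurable X]setTI; exact: measurable_coset_pi.
Qed.

Lemma preimage_image_coset_pi (D : set G) :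
  pi @^-1` (pi @` D) = [set (z.1 * z.2)%g | z in D `*` [set` K]].
Proof.
apply/seteqP; split=> [x [y Dy /coset_pi_eqP yx]|x [[y k] /= [Dy kK] <-]].
  by exists (y, (y^-1 * x)%g) => //=; rewrite mulgA mulgV mul1g.
by exists y => //; rewrite coset_pi_mulr.
Qed.

Lemma compact_preimage_image_coset_pi (D : set G) : compact [set` K] ->
  compact D -> compact (pi @^-1` (pi @` D)).
Proof.
move=> cK cD; rewrite preimage_image_coset_pi; apply: continuous_compact.
  exact/continuous_subspaceT/mulg_continuous.
exact: compact_setX.
Qed.

(** Open sets of the quotient are those with open preimage, and the preimage of pi(D) is the product
    D K, which is compact and thus closed in [G]. This makes pi(D) a Borel set. *)
Lemma closed_image_coset_pi (D : set G) : hausdorff_space G ->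
  compact [set` K] -> compact D -> closed (pi @` D).
Proof.
move=> hG cK cD; rewrite -[X in closed X]setCK; apply: open_closedC.
suff : open (~` (pi @^-1` (pi @` D))) by [].
apply: closed_openC; apply: compact_closed => //.
exact: compact_preimage_image_coset_pi.
Qed.

Section induced.
Context (A : G -> G) (A_aut : top_automorphism A).
Hypothesis A_K : A @` [set` K] = [set` K].

(** The representative of [pi x] is x k with k in [K], and the factor A(k) stays in [K]. *)
Lemma induced_coset_pi (x : G) : induced A (pi x) = pi (A x).
Proof.
have [AM _ _] := A_aut; have [k kK xk] := repr_coset_piP x.
rewrite /induced xk AM coset_pi_mulr//.
by have : [set` K] (A k) by rewrite -A_K; exists k.
Qed.

Lemma induced_continuous : continuous (induced A : coset_space K -> coset_space K).
Proof.
apply/quotient_continuous.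
have -> : induced A \o \pi_(coset_space K)%qT = pi \o A.
  by apply/funext => x /=; exact: induced_coset_pi.
have [_ cA _] := A_aut.
by move=> x; apply: continuous_comp; [exact: cA|exact: coset_pi_continuous].
Qed.

Lemma measurable_induced : measurable_fun setT
  (induced A : borel (coset_space K) -> borel (coset_space K)).
Proof. apply: continuous_borel_measurable; exact: induced_continuous. Qed.

End induced.

(** * Weil's formula, and the effect of induced maps on the measure of G/K *)

Section weil.
Local Open Scope ereal_scope.
Context (R : realType) (G_hausdorff : hausdorff_space G).
Hypothesis K_compact : compact [set` K].
Context (nu kappa : {measure set (borel G) -> \bar R}).
Context (lam : {measure set (borel (coset_space K)) -> \bar R}).
Hypothesis nu_radon : radon nu.
Hypothesis kappa_K : kappa [set` K] = 1.
Hypothesis weil : weil_formula nu kappa lam.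

Let measurable_K : measurable ([set` K] : set (borel G)).
Proof. by apply: borel_closed; exact: compact_closed. Qed.

(** Weil's formula for the indicator of the preimage of [E]: it is constant on cosets and [kappa]
    gives [K] mass 1, so the inner integral is the indicator of [E]. Finiteness is what makes this
    indicator integrable, as the formula requires. *)
Let weil_measure_fin (E : set (borel (coset_space K))) : measurable E ->
  nu (pi @^-1` E) < +oo -> lam E = nu (pi @^-1` E).
Proof.
move=> mE Eoo; have mpE := measurable_preimage_coset_pi mE.
have : nu.-integrable setT (EFin \o (\1_(pi @^-1` E) : borel G -> R)).
  apply/integrableP; split.
    by apply/measurable_EFinP; exact: measurable_indic.
  under eq_integral do rewrite /= ger0_norm//.
  by rewrite integral_indic// setIT.
move=> /weil; rewrite integral_indic// setIT => ->.
transitivity (\int[lam]_y (\1_E y)%:E); first by rewrite integral_indic// setIT.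
apply: eq_integral => y _.
transitivity (\int[kappa]_(k in [set` K]) (cst (\1_E y)%:E k)).
  by rewrite integral_cst// kappa_K mule1.
apply: eq_integral => k; rewrite inE /= => kK; congr _%:E; rewrite !indicE.
by congr (nat_of_bool _)%:R; apply/idP/idP; rewrite !inE /=;
  rewrite coset_pi_mulr// coset_pi_repr.
Qed.

(** The preimage D K of pi(D) is compact, so it has finite measure and the finite case of the
    identity applies to pi(D). Such images carry inner regularity of [nu] over to [lam]. *)
Let weil_measure_compact (D : set G) : compact D ->
  [/\ measurable (pi @` D : set (borel (coset_space K))),
      lam (pi @` D) < +oo & nu D <= lam (pi @` D)].
Proof.
move=> cD; have mpD := borel_closed (closed_image_coset_pi G_hausdorff K_compact cD).
have [compact_fin _] := nu_radon.
have pDoo := compact_fin _ (compact_preimage_image_coset_pi K_compact cD).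
split; rewrite ?weil_measure_fin//; apply: le_measure => //; rewrite ?inE//.
- by apply: borel_closed; exact: compact_closed.
- exact: measurable_preimage_coset_pi.
- exact: preimage_image.
Qed.

(** If the preimage has infinite measure, the compact sets [D] inside it have unbounded measure, and
    [lam E] dominates each lam(pi(D)), which is at least [nu D]. *)
Lemma weil_measure (E : set (borel (coset_space K))) : measurable E ->
  lam E = nu (pi @^-1` E).
Proof.
move=> mE; have [|] := ltP (nu (pi @^-1` E)) +oo; first exact: weil_measure_fin.
rewrite leye_eq => /eqP pEoo; apply/eqP; rewrite eq_le pEoo leey/= -pEoo.
have [_ ->] := nu_radon; last exact: measurable_preimage_coset_pi.
apply: ge_ereal_sup => _ [D [cD DE] <-].
have [mpD _ /le_trans] := weil_measure_compact cD; apply.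
apply: le_measure => //; rewrite ?inE//.
by move=> _ [x Dx <-]; exact: DE.
Qed.

(** The images pi(D) of the compact sets [D] in the preimage of [E] are subsets of [E] of finite
    measure, large enough to approximate [lam E]. *)
Lemma semifinite_weil : semifinite lam.
Proof.
move=> E c mE lamEc; rewrite weil_measure//.
have [_ ->] := nu_radon; last exact: measurable_preimage_coset_pi.
apply: ge_ereal_sup => _ [D [cD DE] <-].
have [mpD pDoo /le_trans] := weil_measure_compact cD; apply.
apply: lamEc => //.
by move=> _ [x Dx <-]; exact: DE.
Qed.

Context (A : G -> G) (A_aut : top_automorphism A).
Hypothesis A_K : A @` [set` K] = [set` K].
Context (a : R) (A_modulus : is_modulus nu A a).

Lemma measure_preimage_induced (E : set (borel (coset_space K))) :
  measurable E -> lam (induced A @^-1` E) = a^-1%:E * lam E.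
Proof.
move=> mE; have [a0 aE] := A_modulus; have [_ cA [B [AB BA _]]] := A_aut.
have mpE := measurable_preimage_coset_pi mE.
have mApE : measurable (A @^-1` (pi @^-1` E) : set (borel G)).
  rewrite -[X in measurable X]setTI.
  exact: (continuous_borel_measurable cA).
rewrite !weil_measure//; last first.
  rewrite -[X in measurable X]setTI; exact: measurable_induced.
have -> : pi @^-1` (induced A @^-1` E) = A @^-1` (pi @^-1` E).
  by apply/seteqP; split=> x /=; rewrite induced_coset_pi.
(* The modulus rescales images, so it is applied to the preimage under [A], whose image is the
   original set because [A] is onto; hence the inverse of [a]. *)
have := aE _ mApE; rewrite image_preimage.
  by move=> ->; rewrite muleA -EFinM mulVf ?mul1e// gt_eqF.
by apply/seteqP; split => // x _; exists (B x).
Qed.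

Lemma ge0_integral_induced (g : borel (coset_space K) -> \bar R) :
  measurable_fun setT g -> (forall y, 0 <= g y) ->
  \int[lam]_y g (induced A y) = a^-1%:E * \int[lam]_y g y.
Proof.
move=> mg g0; have [a0 _] := A_modulus.
have a0' : (0 <= a^-1)%R by rewrite invr_ge0 ltW.
have mA := measurable_induced A_aut A_K.
rewrite -(@ge0_integral_pushforward _ _ _ _ _ _ mA lam setT g)//.
rewrite -[a^-1%R]/((NngNum a0')%:num) -ge0_integral_mscale//.
apply: eq_measure_integral => E mE _.
by rewrite /= /pushforward measure_preimage_induced// /mscale/=.
Qed.

End weil.
End cosets.

(** * Boundedness of the Hausdorff operator *)

Section hausdorff_bound.
Local Open Scope ereal_scope.
Context (R : realType) (G : topGroupType) (K : groupClosed G).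
Context (lam : {measure set (borel (coset_space K)) -> \bar R}).
Context d (Omega : measurableType d) (mu : {measure set Omega -> \bar R}).
Context (Phi : Omega -> R[i]) (A : Omega -> G -> G) (modA : Omega -> R).
Context (p : \bar R) (p1 : 1 <= p).
Hypothesis lam_semifinite : semifinite lam.
Hypothesis modA_gt0 : forall u, (0 < modA u)%R.
Hypothesis A_measurable : forall u, measurable_fun setT
  (induced (A u) : borel (coset_space K) -> borel (coset_space K)).
Hypothesis A_measure : forall u (E : set (borel (coset_space K))), measurable E ->
  lam (induced (A u) @^-1` E) = (modA u)^-1%:E * lam E.
Hypothesis A_integral : forall u (g : borel (coset_space K) -> \bar R),
  measurable_fun setT g -> (forall y, 0 <= g y) ->
  \int[lam]_y g (induced (A u) y) = (modA u)^-1%:E * \int[lam]_y g y.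
Hypothesis A_meas : measurable_integrand Phi A lam p.
Hypothesis weight_meas : measurable_fun setT (weight Phi modA p).
Hypothesis norm_fin : weighted_norm mu Phi modA p < +oo.

Local Notation W := (weighted_norm mu Phi modA p).
Local Notation integrand := (hausdorff_integrand Phi A).
Local Notation H := (@hausdorff_op R G K d Omega mu Phi A).
Local Notation Lp := (Lp lam p).
Local Notation Lp_norm := (Lp_norm lam p).
Implicit Types f g : borel (coset_space K) -> R[i].

Let p_gt0 : 0 < p. Proof. exact: lt_le_trans p1. Qed.

Let weight_ge0 u : (0 <= weight Phi modA p u)%R.
Proof. by rewrite mulr_ge0 ?normc_ge0 ?powR_ge0. Qed.

Let W_ge0 : 0 <= W.
Proof. by apply: integral_ge0 => u _; rewrite lee_fin. Qed.

Let weight_eq0 u : weight Phi modA p u = 0%R -> Phi u = 0%R.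
Proof.
move=> /eqP; rewrite mulf_eq0 => /orP[/eqP|]; first exact: Normc.eq0_normc.
by rewrite gt_eqF// powR_gt0.
Qed.

Let integrand_eq0 f u y : weight Phi modA p u = 0%R -> integrand f u y = 0%R.
Proof. by move=> /weight_eq0; rewrite /hausdorff_integrand => ->; rewrite mul0r. Qed.

Let measurable_Lp f : Lp f -> cmeasurable f. Proof. by case. Qed.

Let cmeasurable_integrand f y : Lp f -> cmeasurable (fun u => integrand f u y).
Proof.
move=> /A_meas[mr mi]; split.
- exact: (measurableT_comp mr (pair2_measurable y)).
- exact: (measurableT_comp mi (pair2_measurable y)).
Qed.

Let measurable_normc_integrand f : Lp f ->
  measurable_fun setT (fun z : Omega * borel (coset_space K) =>
    normc (integrand f z.1 z.2)).
Proof. by move=> /A_meas; exact: measurable_normc. Qed.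

Let Lp_norm_fin f : Lp f -> Lp_norm f = (fine (Lp_norm f))%:E.
Proof. by move=> [_ foo]; rewrite fineK// ge0_fin_numE// Lnorm_ge0. Qed.

(** For finite [p = r], the change of variables yields the inverse modulus inside the [r]-th root,
    hence the power -1/r. For [p = +oo] only the invariance of null sets matters, and the weight is
    |Phi(u)|. *)
Lemma Lp_norm_integrand f u : Lp f ->
  Lp_norm (integrand f u) <= (weight Phi modA p u)%:E * Lp_norm f.
Proof.
move=> Lf; have mnf := measurable_normc (measurable_Lp Lf).
rewrite /Defs.Lp_norm /weight /hausdorff_integrand.
have [[r r_ge1 pr]|py] : (exists2 r, (1 <= r)%R & p = r%:E) \/ p = +oo.
  move: p1; case: (p) => [r r1| _|//]; [left; exists r => //|by right].
- rewrite pr /=; have r0 : (0 < r)%R by exact: lt_le_trans r_ge1.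
  pose g y : \bar R := `|(normc (f y))%:E| `^ r.
  have mg : measurable_fun setT g.
    apply: (@measurableT_comp _ _ _ _ _ _ (fun x => x `^ r)).
      exact: measurable_poweR.
    by apply: (@measurableT_comp _ _ _ _ _ _ abse) => //; exact/measurable_EFinP.
  have g0 y : 0 <= g y by exact: poweR_ge0.
  have I0 : 0 <= \int[lam]_y g y by exact: integral_ge0.
  rewrite unlock -/(g _).
  have -> : \int[lam]_y (`|(normc (Phi u * f (induced (A u) y))%R)%:E| `^ r) =
      (normc (Phi u) `^ r)%:E * ((modA u)^-1%:E * \int[lam]_y g y).
    rewrite -A_integral// -ge0_integralZl//; last 2 first.
    - exact: (measurableT_comp mg (A_measurable u)).
    - by rewrite lee_fin powR_ge0.
    apply: eq_integral => y _; rewrite /g Normc.normcM EFinM abseM poweRM//.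
    by rewrite /= ger0_norm ?normc_ge0// poweR_EFin.
  rewrite muleA poweRM ?mule_ge0 ?lee_fin ?powR_ge0 ?invr_ge0 ?(ltW (modA_gt0 u))//.
  rewrite -EFinM poweR_EFin powRM ?powR_ge0 ?invr_ge0 ?(ltW (modA_gt0 u))//.
  rewrite -powRrM divff ?gt_eqF// powRr1 ?normc_ge0//.
  by rewrite -powR_inv1 ?(ltW (modA_gt0 u))// -powRrM mulN1r.
- rewrite py /= oppr0 powRr0 mulr1.
  rewrite unlock /=; case: ifPn => [lam0|_]; last by rewrite mule0.
  apply/ess_supP.
  have : {ae lam, forall y, (normc (f y))%:E <=
      ess_sup lam (abse \o (fun y => (normc (f y))%:E))}.
    apply: filterS (ess_sup_ge _ (abse \o (fun y => (normc (f y))%:E))) => y.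
    by rewrite /= ger0_norm// normc_ge0.
  (* The exceptional set of [f] is pulled back by the induced map; it stays null because [lam] is
     only rescaled. *)
  move=> [N [mN N0 fN]]; exists (induced (A u) @^-1` N); split.
  - by rewrite -[X in measurable X]setTI; exact: A_measurable.
  - by rewrite A_measure// N0 mule0.
  move=> y /= fy; apply: fN => /= fAy; apply: fy.
  rewrite Normc.normcM ger0_norm ?mulr_ge0 ?normc_ge0// EFinM.
  by apply: lee_wpmul2l; rewrite ?lee_fin ?normc_ge0.
Qed.

(** The extended-real majorant of |H f|. It is [+oo] where the absolute integral diverges, so the
    majoration holds at every [y], whatever value [H f] takes there. *)
Let h f y := \int[mu]_u (normc (integrand f u y))%:E.

Let h_ge0 f y : 0 <= h f y.
Proof. by apply: integral_ge0 => u _; rewrite lee_fin normc_ge0. Qed.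

Let measurable_h f : Lp f -> measurable_fun setT (h f).
Proof.
move=> Lf.
apply: (measurable_fun_integral_support weight_meas weight_ge0 norm_fin
  (f := fun z => (normc (integrand f z.1 z.2))%:E)).
  by apply/measurable_EFinP; exact: measurable_normc_integrand.
by move=> u y wu; rewrite integrand_eq0// Normc.normc0.
Qed.

Let Lnorm_h f : Lp f -> 'N[lam]_p[h f] <= W * Lp_norm f.
Proof.
move=> Lf; rewrite (Lp_norm_fin Lf).
apply: (minkowski_integral weight_meas weight_ge0 norm_fin lam_semifinite p1
  (F := fun z => normc (integrand f z.1 z.2))).
- exact: measurable_normc_integrand.
- by move=> z; exact: normc_ge0.
- by apply: fine_ge0; exact: Lnorm_ge0.
- by move=> u y wu; rewrite integrand_eq0// Normc.normc0.
- by move=> u; rewrite EFinM -Lp_norm_fin//; exact: Lp_norm_integrand.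
Qed.

(** Minkowski's inequality for the absolute values makes the norm of [h f] finite, so [h f] is
    finite almost everywhere. *)
Lemma hausdorff_integrand_ae_cintegrable f : Lp f ->
  {ae lam, forall y, cintegrable mu setT (fun u => integrand f u y)}.
Proof.
move=> Lf; have mh := measurable_h Lf.
have : 'N[lam]_p[h f] < +oo.
  apply: le_lt_trans (Lnorm_h Lf) _; rewrite (Lp_norm_fin Lf) muleC.
  rewrite lte_mul_pinfty ?lee_fin// fine_ge0//; exact: Lnorm_ge0.
move=> /(Lnorm_lty_ae p_gt0 mh); apply: filterS => y; rewrite gee0_abs// => hy.
by apply: normc_cintegrable => //; exact: cmeasurable_integrand.
Qed.

(** Points of divergence need no separate treatment: the real and imaginary parts are [fine] of
    extended integrals, which are measurable in [y] without any convergence. *)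
Let cmeasurable_H f : Lp f -> cmeasurable (H f).
Proof.
move=> Lf; have [mr mi] := A_meas Lf; split.
- apply: (measurableT_comp (fine_measurable _)) => //.
  apply: (measurable_fun_integral_support weight_meas weight_ge0 norm_fin
    (f := fun z => (complex.Re (integrand f z.1 z.2))%:E)).
    exact/measurable_EFinP.
  by move=> u y /integrand_eq0 ->.
- apply: (measurableT_comp (fine_measurable _)) => //.
  apply: (measurable_fun_integral_support weight_meas weight_ge0 norm_fin
    (f := fun z => (complex.Im (integrand f z.1 z.2))%:E)).
    exact/measurable_EFinP.
  by move=> u y /integrand_eq0 ->.
Qed.

Lemma Lp_norm_hausdorff_le f : Lp f -> Lp_norm (H f) <= W * Lp_norm f.
Proof.
move=> Lf; apply: le_trans (Lnorm_h Lf); apply: ae_le_Lnorm => //.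
- by apply/measurable_EFinP; apply: measurable_normc; exact: cmeasurable_H.
- exact: measurable_h.
- apply: aeW => y; rewrite (gee0_abs (h_ge0 _ _)) gee0_abs ?lee_fin ?normc_ge0//.
  by apply: normc_cintegral_le; exact: cmeasurable_integrand.
Qed.

Let Lp_hausdorff f : Lp f -> Lp (H f).
Proof.
move=> Lf; split; first exact: cmeasurable_H.
apply: le_lt_trans (Lp_norm_hausdorff_le Lf) _; rewrite (Lp_norm_fin Lf) muleC.
rewrite lte_mul_pinfty ?lee_fin// fine_ge0//; exact: Lnorm_ge0.
Qed.

Let hausdorff_linear (a : R[i]) f g : Lp f -> Lp g ->
  H (fun y => a * f y + g y)%R = (fun y => a * H f y + H g y)%R %[ae lam].
Proof.
move=> Lf Lg.
apply: filterS2 (hausdorff_integrand_ae_cintegrable Lf)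
  (hausdorff_integrand_ae_cintegrable Lg) => y fy gy _.
rewrite /hausdorff_op -cintegral_linear//; congr (cintegral _ _ _).
by apply/funext => u; rewrite /hausdorff_integrand mulrDr mulrCA.
Qed.

(** The null set where [f] and [g] differ has a different preimage for each [u], and a union over
    all [u] is out of control. Instead [k = f - g] has norm 0, the norm bound forces [H k] to vanish
    almost everywhere, and linearity applied to [1 * k + g] concludes. *)
Let hausdorff_ae_eq f g : Lp f -> Lp g -> f = g %[ae lam] -> H f = H g %[ae lam].
Proof.
move=> Lf Lg fg; pose k y := (f y - g y)%R.
have mk : cmeasurable k.
  have [mfr mfi] := measurable_Lp Lf; have [mgr mgi] := measurable_Lp Lg.
  split.
  - rewrite [X in measurable_fun _ X](_ : _ =
      (fun y => complex.Re (f y) - complex.Re (g y))%R).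
      exact: measurable_funB.
    by apply/funext => y; rewrite /k; case: (f y) (g y) => ? ? [].
  - rewrite [X in measurable_fun _ X](_ : _ =
      (fun y => complex.Im (f y) - complex.Im (g y))%R).
      exact: measurable_funB.
    by apply/funext => y; rewrite /k; case: (f y) (g y) => ? ? [].
have k0 : Lp_norm k = 0.
  apply/eqP; rewrite eq_le Lnorm_ge0 andbT -(Lnorm0 lam (negbT (gt_eqF p_gt0))).
  apply: ae_le_Lnorm => //.
    by apply/measurable_EFinP; exact: measurable_normc.
  apply: filterS fg => y /(_ I) fgy.
  by rewrite /k fgy subrr Normc.normc0.
have Lk : Lp k by split => //; rewrite k0.
have Hk0 : (fun y => (normc (H k y))%:E) = \0 %[ae lam].
  apply: Lnorm_eq0_eq0 p_gt0 _ => //.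
    by apply/measurable_EFinP; apply: measurable_normc; exact: cmeasurable_H.
  apply/eqP; rewrite eq_le Lnorm_ge0 andbT.
  by apply: le_trans (Lp_norm_hausdorff_le Lk) _; rewrite k0 mule0.
have fE : f = (fun y => 1 * k y + g y)%R.
  by apply/funext => y; rewrite mul1r subrK.
apply: filterS2 Hk0 (hausdorff_linear 1%R Lk Lg) => y /(_ I) Hky /(_ I).
have /Normc.eq0_normc Hk : normc (H k y) = 0%R by case: Hky.
by rewrite -fE => ->; rewrite Hk mulr0 add0r.
Qed.

Lemma hausdorff_bounded : Lp_bounded lam p H.
Proof.
split; first by split;
  [exact: Lp_hausdorff|exact: hausdorff_ae_eq|exact: hausdorff_linear].
exists (fine W) => f Lf; rewrite fineK ?ge0_fin_numE//.
exact: Lp_norm_hausdorff_le.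
Qed.

Lemma hausdorff_opnorm_le : Lp_opnorm lam p H <= W.
Proof.
apply: ge_ereal_sup => _ [f [Lf f1] <-].
apply: le_trans (Lp_norm_hausdorff_le Lf) _.
by rewrite -[leRHS]mule1; apply: lee_wpmul2l.
Qed.

End hausdorff_bound.

Unset Implicit Arguments.

Theorem theorem1 (R : realType)
    (G : topGroupType) (G_hausdorff : hausdorff_space G)
    (G_lc : locally_compact [set: G])
    (K : groupClosed G) (K_compact : compact [set` K])
    (nu : {measure set (borel G) -> \bar R}) (nu_haar : left_haar nu)
    (kappa : {measure set (borel G) -> \bar R})
    (kappa_haar : normalized_haar K kappa)
    (lam : {measure set (borel (coset_space K)) -> \bar R})
    (lam_radon : radon lam) (lam_inv : left_invariant lam)
    (weil : weil_formula nu kappa lam)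
    (d : measure_display) (Omega : measurableType d)
    (mu : {measure set Omega -> \bar R})
    (loc : set (set Omega)) (Phi : Omega -> R[i]) (Phi_loc : L1loc mu loc Phi)
    (A : Omega -> G -> G) (A_aut : forall u, top_automorphism (A u))
    (A_K : forall u, A u @` [set` K] = [set` K])
    (modA : Omega -> R) (modA_modulus : forall u, is_modulus nu (A u) (modA u))
    (p : \bar R) (p_ge1 : (1 <= p)%E)
    (A_meas : measurable_integrand Phi A lam p)
    (weight_meas : measurable_fun setT (weight Phi modA p))
    (norm_fin : (weighted_norm mu Phi modA p < +oo)%E) :
  (forall f : borel (coset_space K) -> R[i], Lp lam p f ->
     {ae lam, forall y, cintegrable mu setT
                          (fun u => hausdorff_integrand Phi A f u y)}) /\
  Lp_bounded lam p (@hausdorff_op R G K d Omega mu Phi A) /\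
  (Lp_opnorm lam p (@hausdorff_op R G K d Omega mu Phi A)
     <= weighted_norm mu Phi modA p)%E.
Proof.
have [nu_radon _ _] := nu_haar; have [_ kappa_K _ _] := kappa_haar.
have modA_gt0 u : 0 < modA u by case: (modA_modulus u).
have A_mble u := measurable_induced (A_aut u) (A_K u).
have sf := semifinite_weil G_hausdorff K_compact nu_radon kappa_K weil.
have A_measure u := measure_preimage_induced G_hausdorff K_compact nu_radon
  kappa_K weil (A_aut u) (A_K u) (modA_modulus u).
have A_integral u := ge0_integral_induced G_hausdorff K_compact nu_radon
  kappa_K weil (A_aut u) (A_K u) (modA_modulus u).
split; [|split].
- exact: (hausdorff_integrand_ae_cintegrable p_ge1 sf modA_gt0 A_mble A_measure
    A_integral A_meas weight_meas norm_fin).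
- exact: (hausdorff_bounded p_ge1 sf modA_gt0 A_mble A_measure A_integral A_meas
    weight_meas norm_fin).
- exact: (hausdorff_opnorm_le p_ge1 sf modA_gt0 A_mble A_measure A_integral A_meas
    weight_meas norm_fin).
Qed.
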